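(* For each $H\subseteq\{r,s\}$, we have $\mathrm{REL}_H=\mathbb{I}\,\mathrm{RRA}_H$; that is, an algebra belongs to $\mathrm{REL}_H$ if and only if it is isomorphic to some $H$-relativized relation set algebra.
   Context: For a set $W\subseteq U\times U$, the full algebra $\mathfrak{Re}(W)=\langle \mathcal{P}(W),\cup,\cap,\setminus,\emptyset,W,\circ,\otimes,\delta\rangle$ has $\delta=\{(x,y)\in W:x=y\}$, $R\circ S=\{(x,y)\in W:\exists z\in U((x,z)\in R\text{ and }(z,y)\in S)\}$ and $\otimes R=\{(x,y)\in W:(y,x)\in R\}$ for $R,S\subseteq W$. A relativized relation set algebra is a subalgebra of some $\mathfrak{Re}(W)$; $W$ is its unit and the smallest $U$ with $W\subseteq U\times U$ is its base. Here $r$ stands for reflexive and $s$ for symmetric; for $H\subseteq\{r,s\}$, a relation $W\subseteq U\times U$ is an $H$-relation on $U$ if it has all properties in $H$. $\mathrm{RRA}_H$ is the class of relativized relation set algebras whose unit is an $H$-relation on its base, and $\mathbb{I}\mathrm{K}$ denotes the class of isomorphic copies of members of $\mathrm{K}$. $\mathrm{REL}$ is the class of algebras $\mathfrak{A}=\langle A,+,\cdot,-,0,1,;,\breve{\ },1'\rangle$ (binary $;$, unary converse $x\mapsto\breve{x}$, constant $1'$) satisfying: (Ax1) $\langle A,+,\cdot,-,0,1\rangle$ is a Boolean algebra; (Ax2) $(x\cdot\breve{y})\breve{}=\breve{x}\cdot y$; (Ax3) $(x+y);z=x;z+y;z$ and $x;(y+z)=x;y+x;z$; (Ax4) $1;0=0$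 and $0;1=0$; (Ax5) $(\breve{x};y)\cdot z=(\breve{x};(y\cdot(\breve{\breve{x}};z)))\cdot z$ and $(x;\breve{y})\cdot z=((x\cdot(z;\breve{\breve{y}}));\breve{y})\cdot z$; (Ax6) $1';x\le x$ and $x;1'\le x$; (Ax7) $1';1'=1'$; (Ax8) $(-(\breve{1});-(\breve{1}))\cdot 1'=0$; (Ax9) $((x\cdot1');y);z=(x\cdot1');(y;z)$, $(x;(y\cdot1'));z=x;((y\cdot1');z)$ and $(x;y);(z\cdot1')=x;(y;(z\cdot1'))$. $\mathrm{REL}_H$ consists of those $\mathfrak{A}\in\mathrm{REL}$ that additionally satisfy (Ax $s$) $\breve{1}=1$ if $s\in H$, and (Ax $r$) $1';1=1$ and $1;1'=1$ if $r\in H$. *)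

(* Defs.v *)
From mathcomp Require Import all_boot.
From mathcomp Require Import boolp classical_sets.

Set Implicit Arguments.
Unset Strict Implicit.
Unset Printing Implicit Defensive.

Local Open Scope classical_set_scope.

Record relalg := RelAlg {
  carrier :> Type;
  join : carrier -> carrier -> carrier;
  meet : carrier -> carrier -> carrier;
  compl : carrier -> carrier;
  zero : carrier;
  one : carrier;
  rcomp : carrier -> carrier -> carrier;
  conv : carrier -> carrier;
  ident : carrier }.

Arguments zero {_}.
Arguments one {_}.
Arguments ident {_}.

Declare Scope relalg_scope.
Delimit Scope relalg_scope with RA.
Notation "x + y" := (join x y) : relalg_scope.
Notation "x * y" := (meet x y) : relalg_scope.
Notation "- x" := (compl x) : relalg_scope.
Notation "0" := (@zero _) : relalg_scope.
Notation "1" := (@one _) : relalg_scope.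
Notation "1'" := (@ident _) (at level 0) : relalg_scope.
Notation "x ;; y" := (rcomp x y) (at level 40, left associativity) : relalg_scope.
Notation "x ^u" := (conv x) (at level 2, left associativity, format "x ^u") :
  relalg_scope.
Notation "x <= y" := (join x y = y) : relalg_scope.

Section Classes.
Local Open Scope relalg_scope.

Record boolean_algebra (A : relalg) : Prop := BooleanAlgebra {
  ba_joinC : forall x y : A, x + y = y + x;
  ba_meetC : forall x y : A, x * y = y * x;
  ba_joinA : forall x y z : A, x + (y + z) = (x + y) + z;
  ba_meetA : forall x y z : A, x * (y * z) = (x * y) * z;
  ba_joinK : forall x y : A, x + (x * y) = x;
  ba_meetK : forall x y : A, x * (x + y) = x;
  ba_meetDr : forall x y z : A, x * (y + z) = (x * y) + (x * z);
  ba_joinDr : forall x y z : A, x + (y * z) = (x + y) * (x + z);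
  ba_join0 : forall x : A, x + 0 = x;
  ba_meet1 : forall x : A, x * 1 = x;
  ba_joinN : forall x : A, x + (- x) = 1;
  ba_meetN : forall x : A, x * (- x) = 0 }.

Record REL (A : relalg) : Prop := InREL {
  Ax1 : boolean_algebra A;
  Ax2 : forall x y : A, (x * y^u)^u = x^u * y;
  Ax3l : forall x y z : A, (x + y) ;; z = (x ;; z) + (y ;; z);
  Ax3r : forall x y z : A, x ;; (y + z) = (x ;; y) + (x ;; z);
  Ax4l : 1 ;; 0 = 0 :> A;
  Ax4r : 0 ;; 1 = 0 :> A;
  Ax5l : forall x y z : A,
    (x^u ;; y) * z = (x^u ;; (y * ((x^u)^u ;; z))) * z;
  Ax5r : forall x y z : A,
    (x ;; y^u) * z = ((x * (z ;; (y^u)^u)) ;; y^u) * z;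
  Ax6l : forall x : A, 1' ;; x <= x;
  Ax6r : forall x : A, x ;; 1' <= x;
  Ax7 : 1' ;; 1' = 1' :> A;
  Ax8 : ((- (1^u)) ;; (- (1^u))) * 1' = 0 :> A;
  Ax9l : forall x y z : A, ((x * 1') ;; y) ;; z = (x * 1') ;; (y ;; z);
  Ax9m : forall x y z : A, (x ;; (y * 1')) ;; z = x ;; ((y * 1') ;; z);
  Ax9r : forall x y z : A, (x ;; y) ;; (z * 1') = x ;; (y ;; (z * 1')) }.

End Classes.

(* The letters r and s: a subset of {r, s} is a term of type [set rs]. *)
Inductive rs := reflx | symm.

Definition REL_ (H : set rs) (A : relalg) : Prop :=
  [/\ REL A,
      H symm -> ((one : A)^u = 1)%RA
    & H reflx -> (1' ;; (one : A) = 1)%RA /\ ((one : A) ;; 1' = 1)%RA].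

Record is_hom (A B : relalg) (f : A -> B) : Prop := IsHom {
  hom_join : forall x y, f (join x y) = join (f x) (f y);
  hom_meet : forall x y, f (meet x y) = meet (f x) (f y);
  hom_compl : forall x, f (compl x) = compl (f x);
  hom_zero : f zero = zero;
  hom_one : f one = one;
  hom_rcomp : forall x y, f (rcomp x y) = rcomp (f x) (f y);
  hom_conv : forall x, f (conv x) = conv (f x);
  hom_ident : f ident = ident }.

Definition isomorphic (A B : relalg) : Prop :=
  exists f : A -> B, is_hom f /\ bijective f.

Definition iso_copies (K : relalg -> Prop) (A : relalg) : Prop :=
  exists B : relalg, K B /\ isomorphic A B.

Record subuniverse (A : relalg) (S : set A) : Prop := SubUniverse {
  sub_join : forall x y, S x -> S y -> S (join x y);
  sub_meet : forall x y, S x -> S y -> S (meet x y);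
  sub_compl : forall x, S x -> S (compl x);
  sub_zero : S zero;
  sub_one : S one;
  sub_rcomp : forall x y, S x -> S y -> S (rcomp x y);
  sub_conv : forall x, S x -> S (conv x);
  sub_ident : S ident }.

Definition subalgebra (A : relalg) (S : set A) (h : subuniverse S) : relalg :=
  @RelAlg {x : A | S x}
    (fun x y => exist _ _ (sub_join h (proj2_sig x) (proj2_sig y)))
    (fun x y => exist _ _ (sub_meet h (proj2_sig x) (proj2_sig y)))
    (fun x => exist _ _ (sub_compl h (proj2_sig x)))
    (exist _ _ (sub_zero h))
    (exist _ _ (sub_one h))
    (fun x y => exist _ _ (sub_rcomp h (proj2_sig x) (proj2_sig y)))
    (fun x => exist _ _ (sub_conv h (proj2_sig x)))
    (exist _ _ (sub_ident h)).

Section FullAlgebra.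
Variables (U : Type) (W : set (U * U)).

Definition powerW := {R : set (U * U) | R `<=` W}.

Local Notation PowerW := (exist (fun R : set (U * U) => R `<=` W)).

Lemma powerU (R S : powerW) : sval R `|` sval S `<=` W.
Proof. by move=> p [/(svalP R)|/(svalP S)]. Qed.

Lemma powerI (R S : powerW) : sval R `&` sval S `<=` W.
Proof. by move=> p [/(svalP R)]. Qed.

Lemma powerD (R : powerW) : W `\` sval R `<=` W.
Proof. by move=> p []. Qed.

Lemma power0 : set0 `<=` W.
Proof. by []. Qed.

Lemma powerT : W `<=` W.
Proof. by []. Qed.

Lemma power_sep (P : set (U * U)) : [set p | W p /\ P p] `<=` W.
Proof. by move=> p []. Qed.

Definition Re : relalg :=
  @RelAlg powerW
    (fun R S => PowerW (sval R `|` sval S) (@powerU R S))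
    (fun R S => PowerW (sval R `&` sval S) (@powerI R S))
    (fun R => PowerW (W `\` sval R) (@powerD R))
    (PowerW set0 power0)
    (PowerW W powerT)
    (fun R S => PowerW
       [set p | W p /\ exists z : U, sval R (p.1, z) /\ sval S (z, p.2)]
       (@power_sep _))
    (fun R => PowerW [set p | W p /\ sval R (p.2, p.1)] (@power_sep _))
    (PowerW [set p | W p /\ p.1 = p.2] (@power_sep _)).

(* The smallest [V] with [W `<=` V `*` V]. *)
Definition base : set U :=
  \bigcap_(V in [set V : set U | W `<=` V `*` V]) V.

Definition H_relation (H : set rs) (V : set U) : Prop :=
  [/\ W `<=` V `*` V,
      H reflx -> forall x, V x -> W (x, x)
    & H symm -> forall x y, W (x, y) -> W (y, x)].

End FullAlgebra.

Definition RRA (H : set rs) (B : relalg) : Prop :=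
  exists (U : Type) (W : set (U * U)) (S : set (Re W)) (h : subuniverse S),
    H_relation W H (base W) /\ B = subalgebra h.

(* Main.v *)
From mathcomp Require Import all_boot.
Require Import Defs.
From mathcomp Require Import boolp classical_sets.

(* The ultrafilters of an algebra A in REL_H, with the relations "c contains
   a ; b" and "b is the converse of a", form an atom structure.  Starting from
   one labelled edge per ultrafilter, one adds, for every edge (p, q) labelled c
   and every a, b with c below a ; b, a fresh point z with edges p -> z and
   z -> q labelled a and b, together with the reversed edges and the loop at z
   whenever the labels have converses and identities.  As the unit of a
   relativized algebra is arbitrary, z need not be joined to any other point,
   so the only triangles to check are those on z, p, q: (Ax5) reverses their
   edges, (Ax9) makes the loops match, and (Ax8) settles the case p = q.  All
   witnesses can thus be added freely, and the points form an inductive type of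
   binary trees.  Sending x to the pairs whose label contains x represents A. *)

Set Implicit Arguments.
Unset Strict Implicit.
Unset Printing Implicit Defensive.

Local Open Scope classical_set_scope.

(** * Representations *)

Section Representation.
Local Open Scope relalg_scope.

(** A map into relations avoids the nested subset types of a subalgebra of [Re W]; clauses stated as
    equalities of propositions can be rewritten with. *)
Record repr (A : relalg) (U : Type) (W : set (U * U)%type)
    (g : A -> U -> U -> Prop) : Prop := Repr {
  repr_sub : forall x p q, g x p q -> W (p, q);
  repr_join : forall x y p q, g (x + y) p q = (g x p q \/ g y p q);
  repr_meet : forall x y p q, g (x * y) p q = (g x p q /\ g y p q);
  repr_compl : forall x p q, g (- x) p q = (W (p, q) /\ ~ g x p q);
  repr_zero : forall p q, g 0 p q = False;
  repr_one : forall p q, g 1 p q = W (p, q);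
  repr_rcomp : forall x y p q,
    g (x ;; y) p q = (W (p, q) /\ exists z, g x p z /\ g y z q);
  repr_conv : forall x p q, g (x^u) p q = (W (p, q) /\ g x q p);
  repr_ident : forall p q, g 1' p q = (W (p, q) /\ p = q);
  repr_inj : forall x y, (forall p q, g x p q <-> g y p q) -> x = y }.

End Representation.

Lemma Re_eq (U : Type) (W : set (U * U)) (R S : Re W) :
  (forall p q, sval R (p, q) <-> sval S (p, q)) -> R = S.
Proof.
case: R S => R RW [S SW] /= RS; apply/eq_exist/predeqP => -[p q]; exact: RS.
Qed.

Lemma hom_range_iso (A B : relalg) (f : A -> B) :
  is_hom f -> injective f ->
  exists h : subuniverse (range f), isomorphic A (subalgebra h).
Proof.
move=> fh finj.
have h : subuniverse (range f).
  split.
  - by move=> _ _ [x _ <-] [y _ <-]; rewrite -hom_join //; exists (x + y)%RA.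
  - by move=> _ _ [x _ <-] [y _ <-]; rewrite -hom_meet //; exists (x * y)%RA.
  - by move=> _ [x _ <-]; rewrite -hom_compl //; exists (- x)%RA.
  - by rewrite -(hom_zero fh); exists 0%RA.
  - by rewrite -(hom_one fh); exists 1%RA.
  - by move=> _ _ [x _ <-] [y _ <-]; rewrite -hom_rcomp //; exists (x ;; y)%RA.
  - by move=> _ [x _ <-]; rewrite -hom_conv //; exists (x^u)%RA.
  - by rewrite -(hom_ident fh); exists 1'%RA.
exists h; exists (fun x => exist _ (f x) (imageP f (I : setT x))); split.
  split.
  - by move=> x y; apply: eq_exist; exact: hom_join.
  - by move=> x y; apply: eq_exist; exact: hom_meet.
  - by move=> x; apply: eq_exist; exact: hom_compl.
  - by apply: eq_exist; exact: hom_zero.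
  - by apply: eq_exist; exact: hom_one.
  - by move=> x y; apply: eq_exist; exact: hom_rcomp.
  - by move=> x; apply: eq_exist; exact: hom_conv.
  - by apply: eq_exist; exact: hom_ident.
pose inv (y : {y : B | range f y}) : A := sval (cid2 (svalP y)).
have invK (y : {y : B | range f y}) : f (inv y) = sval y.
  by rewrite /inv; case: cid2.
exists inv => [x|y]; first by apply: finj; rewrite invK.
by case: y (invK y) => y yf /= e; exact: eq_exist.
Qed.

Lemma iso_copies_RRAP (H : set rs) (A : relalg) : iso_copies (RRA H) A <->
  exists (U : Type) (W : set (U * U)) (g : A -> U -> U -> Prop),
    repr W g /\ H_relation W H (base W).
Proof.
split.
  move=> [_ [[U [W [S [h [HW ->]]]]] [f [fh fb]]]].
  exists U, W, (fun x p q => sval (sval (f x)) (p, q)); split=> //; split.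
  - by move=> x p q; exact: (svalP (sval (f x))).
  - by move=> x y p q; rewrite hom_join.
  - by move=> x y p q; rewrite hom_meet.
  - by move=> x p q; rewrite hom_compl.
  - by move=> p q; rewrite hom_zero.
  - by move=> p q; rewrite hom_one.
  - by move=> x y p q; rewrite hom_rcomp.
  - by move=> x p q; rewrite hom_conv.
  - by move=> p q; rewrite hom_ident.
  - move=> x y /Re_eq e; apply: (bij_inj fb).
    by case: (f x) (f y) e => [X SX] [Y SY] /= ?; exact: eq_exist.
move=> [U [W [g [gr HW]]]].
have gW x : [set p | g x p.1 p.2] `<=` W.
  by move=> [p q]; exact: repr_sub gr x p q.
pose f x : Re W := exist (fun R => R `<=` W) _ (gW x).
have fh : is_hom f.
  split.
  - by move=> x y; apply: Re_eq => p q /=; rewrite (repr_join gr).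
  - by move=> x y; apply: Re_eq => p q /=; rewrite (repr_meet gr).
  - by move=> x; apply: Re_eq => p q /=; rewrite (repr_compl gr).
  - by apply: Re_eq => p q /=; rewrite (repr_zero gr).
  - by apply: Re_eq => p q /=; rewrite (repr_one gr).
  - by move=> x y; apply: Re_eq => p q /=; rewrite (repr_rcomp gr).
  - by move=> x; apply: Re_eq => p q /=; rewrite (repr_conv gr).
  - by apply: Re_eq => p q /=; rewrite (repr_ident gr).
have finj : injective f.
  move=> x y e; apply: (repr_inj gr) => p q.
  by rewrite -[g x p q]/(sval (f x) (p, q)) e.
have [h Ah] := hom_range_iso fh finj.
by exists (subalgebra h); split=> //; exists U, W, (range f), h.
Qed.

(** The set of all endpoints of edges is one of the sets that [base] intersects. *)
Lemma base_edge (U : Type) (W : set (U * U)) x :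
  base W x -> exists y, W (x, y) \/ W (y, x).
Proof.
move=> /(_ [set x | exists y, W (x, y) \/ W (y, x)]).
by apply=> -[p q] Wpq; split; [exists q|exists p]; tauto.
Qed.

Lemma sub_base (U : Type) (W : set (U * U)) : W `<=` base W `*` base W.
Proof. by move=> [p q] Wpq; split=> V /(_ _ Wpq) []. Qed.

(** * Soundness: represented algebras satisfy the axioms *)

Lemma repr_REL (A : relalg) (U : Type) (W : set (U * U))
  (g : A -> U -> U -> Prop) : repr W g -> REL A.
Proof.
move=> gr.
have sub := repr_sub gr.
(* Equalities between functions of both points can be rewritten under the quantified midpoint of a
   composition. *)
pose ext f h := (@funeq2P U U Prop f h).2.
pose E := (fun x y => ext _ _ (repr_join gr x y),
  fun x y => ext _ _ (repr_meet gr x y), fun x => ext _ _ (repr_compl gr x),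
  ext _ _ (repr_zero gr), ext _ _ (repr_one gr),
  fun x y => ext _ _ (repr_rcomp gr x y), fun x => ext _ _ (repr_conv gr x),
  ext _ _ (repr_ident gr)).
split; first split.
1-12: by move=> *; apply: (repr_inj gr) => p q; rewrite !E; move: (sub);
  firstorder; apply: contrapT => ?; firstorder.
all: try move=> x; try move=> y; try move=> z; apply: (repr_inj gr) => p q.
all: rewrite !E.
- by have := sub x; firstorder.
- by firstorder.
- by firstorder.
- by firstorder.
- by firstorder.
- by have := sub z; firstorder.
- by have := sub z; firstorder.
- by split=> [[[_ [z [[_ ->]]]] //|//]|?]; right.
- by split=> [[[_ [z [h [_ <-]]]] //|//]|?]; right.
- by split=> [[Wpq [z [[_ e] [_ e']]]]|[Wpq e]]; subst; split=> //; exists q.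
(* In (Ax8), [1'] closes the path, so the second edge reverses the first and puts it into [1^u]. *)
- by split=> // -[[_ [z [[Wpz n] [Wzq _]]]] [_ e]]; subst; case: n.
(* In each law of (Ax9) the subidentity merges two points, so both bracketings describe one
   triangle, and [sub] supplies the missing edge. *)
- split=> [[Wpq [z0 [[Wpz [t [[xt [Wpt e]] yt]]] zq]]]|]; subst.
    by split=> //; exists t; split=> //; split=> //; exists z0.
  move=> [Wpq [z0 [[xt [Wpt e]] [Wzq [t [yt zt]]]]]]; subst.
  by split=> //; exists t; split=> //; split; [exact: sub yt|exists z0].
- split=> [[Wpq [z0 [[Wpz [t [xt [yt [Wtz e]]]]] zq]]]|]; subst.
    by split=> //; exists z0; split=> //; split; [exact: sub zq|exists z0].
  move=> [Wpq [z0 [xt [Wzq [t [[yt [Wzt e]] zt]]]]]]; subst.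
  by split=> //; exists t; split=> //; split; [exact: sub xt|exists t].
- split=> [[Wpq [z0 [[Wpz [t [xt yt]]] [zq [Wzq e]]]]]|]; subst.
    by split=> //; exists t; split=> //; split; [exact: sub yt|exists q].
  move=> [Wpq [z0 [xz [Wzq [t [yt [zt [Wtq e]]]]]]]]; subst.
  by split=> //; exists q; split=> //; split=> //; exists z0.
Qed.

Lemma repr_REL_ (H : set rs) (A : relalg) (U : Type) (W : set (U * U))
  (g : A -> U -> U -> Prop) : repr W g -> H_relation W H (base W) -> REL_ H A.
Proof.
move=> gr [WB Hr Hs]; split; first exact: repr_REL gr.
  move=> /Hs Ws; apply: (repr_inj gr) => p q.
  rewrite (repr_conv gr) !(repr_one gr); split=> [[]//|Wpq].
  by split=> //; exact: Ws.
move=> /Hr Wr; split; apply: (repr_inj gr) => p q;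
  rewrite (repr_rcomp gr) (repr_one gr);
  (split=> [[]//|Wpq]; split=> //; case: (WB _ Wpq) => /= /Wr Wp /Wr Wq).
  by exists p; rewrite (repr_ident gr) (repr_one gr).
by exists q; rewrite (repr_ident gr) (repr_one gr).
Qed.

(** * Atom structures *)

(* [tri a b c] reads "c is below a ; b", [cv a b] reads "b is the converse of
   a" (an atom may have none) and [idat e] reads "e is below 1'". *)
Record frame := Frame {
  atom :> Type;
  tri : atom -> atom -> atom -> Prop;
  cv : atom -> atom -> Prop;
  idat : atom -> Prop;
  cv_sym : forall a b, cv a b -> cv b a;
  cv_fun : forall a b c, cv a b -> cv a c -> b = c;
  tri_revl : forall a b c a', tri a b c -> cv a a' -> tri a' c b;
  tri_revr : forall a b c b', tri a b c -> cv b b' -> tri c b' a;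
  idat_l : forall e a c, idat e -> tri e a c -> c = a;
  idat_r : forall e a c, idat e -> tri a e c -> c = a;
  idat_tri : forall e, idat e -> tri e e e;
  idat_cv : forall a b c, idat c -> tri a b c ->
    (exists a', cv a a') \/ (exists b', cv b b');
  idat_src : forall e a b c, idat e -> tri a b c -> tri e a a <-> tri e c c;
  idat_mid : forall e a b c, idat e -> tri a b c -> tri a e a <-> tri e b b;
  idat_tgt : forall e a b c, idat e -> tri a b c -> tri b e b <-> tri c e c }.

Section Network.
Variable F : frame.
Implicit Types a b c e : F.

(** [idat_cv] on the triangle [e, e, e] yields a converse of [e]; reversing the triangle with it and
    cancelling the identity shows that it is [e]. *)
Lemma idat_conv e : idat e -> cv e e.
Proof.
move=> Ie; have ee := idat_tri Ie.
by case: (idat_cv Ie ee) => -[e' ce];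
  [move: (idat_r Ie (tri_revl ee ce)) | move: (idat_l Ie (tri_revr ee ce))];
  move=> {2}->.
Qed.

Lemma idat_tri_cv a b c : idat c -> tri a b c -> cv a b.
Proof.
move=> Ic abc; case: (idat_cv Ic abc) => -[d cd].
  by rewrite (idat_r Ic (tri_revl abc cd)).
by rewrite (idat_l Ic (tri_revr abc cd)); exact: cv_sym.
Qed.

Lemma idat_of_cv a b : cv a b -> idat b -> idat a.
Proof. by move=> /cv_sym ab Ib; rewrite -(cv_fun (idat_conv Ib) ab). Qed.

(** The identity atoms at the source and target of [a]: at most one each, and possibly none, since
    the unit need not be reflexive. *)
Definition lid a e := idat e /\ tri e a a.
Definition rid a e := idat e /\ tri a e a.

Lemma lid_cv a b e : cv a b -> lid a e <-> rid b e.
Proof.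
move=> ab; have ba := cv_sym ab; split=> -[Ie h]; split=> //.
  exact: tri_revl (tri_revr h ab) ab.
exact: tri_revr (tri_revl h ba) ba.
Qed.

(** As [a] lies below [e ; a], the left identity [e'] of [a] is also one of [e]; two composable
    identities are equal. *)
Lemma lid_inj a e e' : lid a e -> lid a e' -> e = e'.
Proof.
move=> [Ie ea] [Ie' ea']; apply: (@idat_r _ e) => //.
by apply/(idat_src Ie' ea).
Qed.

Lemma rid_inj a e e' : rid a e -> rid a e' -> e = e'.
Proof.
move=> [Ie ea] [Ie' ea']; apply: (@idat_l _ e) => //.
by apply/(idat_tgt Ie' ea).
Qed.

Lemma lid_src a b c e : tri a b c -> lid a e <-> lid c e.
Proof. by move=> abc; split=> -[Ie h]; split=> //; apply/(idat_src Ie abc). Qed.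

Lemma rid_mid a b c e : tri a b c -> rid a e <-> lid b e.
Proof. by move=> abc; split=> -[Ie h]; split=> //; apply/(idat_mid Ie abc). Qed.

Lemma rid_tgt a b c e : tri a b c -> rid b e <-> rid c e.
Proof. by move=> abc; split=> -[Ie h]; split=> //; apply/(idat_tgt Ie abc). Qed.

Lemma idat_lid e e' : idat e -> lid e e' <-> e' = e.
Proof.
move=> Ie; split=> [h|->]; last by split=> //; exact: idat_tri.
exact: lid_inj h (conj Ie (idat_tri Ie)).
Qed.

Lemma idat_rid e e' : idat e -> rid e e' <-> e' = e.
Proof. by move=> Ie; rewrite -(lid_cv _ (idat_conv Ie)) idat_lid. Qed.

(** * The tree of witnesses *)

(* Every triangle [tri a b c] over an edge labelled [c] from [p] to [q] gets its
   own witness [node p q a b], joined only to [p] and [q].  The points [root c]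
   and [top c] start a component containing an edge labelled [c]; when [c] is
   an identity atom, the edge is a loop on [root c] and [top c] is not used. *)
Inductive pt := root of F | top of F | node of pt & pt & F & F.

(* [up z x a]: [x] is a parent of [z] and [a] labels the edge from [x] to [z];
   [down z x a]: the same for the edge from [z] to [x]. *)
Definition up z x a := match z with
  | root _ => False
  | top c => x = root c /\ a = c
  | node p q a0 b0 => (x = p /\ a = a0) \/ (x = q /\ cv b0 a) end.

Definition down z x b := match z with
  | root _ => False
  | top c => x = root c /\ cv c b
  | node p q a0 b0 => (x = q /\ b = b0) \/ (x = p /\ cv a0 b) end.

(** At a node the target identity of the first factor is also the source identity of the second, by
    [rid_mid], so naming one suffices. *)
Definition loop z e := match z with
  | root c => lid c e
  | top c => rid c e
  | node _ _ a _ => rid a e end.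

Definition label u v c := [\/ u = v /\ loop u c, up v u c | down u v c].

(** Identity atoms are excluded because they may label loops only; the last clause demands that the
    witness sits over an actual edge. *)
Fixpoint valid z : Prop := match z with
  | root _ => True
  | top c => ~ idat c
  | node p q a b => [/\ valid p, valid q, ~ idat a, ~ idat b
                      & exists c, label p q c /\ tri a b c] end.

Definition parent z x := exists a, up z x a \/ down z x a.

Fixpoint height z : nat :=
  if z is node p q _ _ then (maxn (height p) (height q)).+1
  else if z is top _ then 1%N else 0%N.

(** This makes parenthood acyclic, which orients every edge and excludes cyclic triples. *)
Lemma parent_height z x : parent z x -> height x < height z.
Proof.
case: z => [c|c|p q a b] [d] [] //=; try by case=> ->.
  by case=> -[-> _]; rewrite ltnS ?leq_maxl ?leq_maxr.
by case=> -[-> _]; rewrite ltnS ?leq_maxl ?leq_maxr.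
Qed.

Lemma parent_irrefl z : ~ parent z z.
Proof. by move=> /parent_height; rewrite ltnn. Qed.

Lemma parent_asym z x : parent z x -> ~ parent x z.
Proof.
by move=> /parent_height h /parent_height /(ltn_trans h); rewrite ltnn.
Qed.

Lemma up_parent z x a : up z x a -> parent z x.
Proof. by move=> h; exists a; left. Qed.

Lemma down_parent z x a : down z x a -> parent z x.
Proof. by move=> h; exists a; right. Qed.

Lemma loop_idat z e : loop z e -> idat e.
Proof. by case: z => [c|c|p q a b] []. Qed.

Lemma loop_inj z e e' : loop z e -> loop z e' -> e = e'.
Proof. by case: z => [c|c|p q a b]; [exact: lid_inj|exact: rid_inj..]. Qed.

Lemma label_diag z c : label z z c -> loop z c.
Proof.
by case=> [[]//|/up_parent/parent_irrefl|/down_parent/parent_irrefl].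
Qed.

Lemma label_parent u v c : label u v c -> u <> v -> parent u v \/ parent v u.
Proof.
by case=> [[]//|/up_parent|/down_parent] h _; [right|left].
Qed.

(** The label below is then an identity, so (Ax8) applies through [idat_tri_cv]. This reconciles the
    two clauses of [up] and [down] when both parents coincide. *)
Lemma node_eq_cv p a b : valid (node p p a b) -> cv a b.
Proof.
by case=> _ _ _ _ [c [/label_diag/loop_idat]]; exact: idat_tri_cv.
Qed.

Lemma up_cv z x a b : up z x a -> cv a b -> down z x b.
Proof.
case: z => [c|c|p q a0 b0] //=; first by case=> -> ->.
case=> -[-> h] ab; [right; split=> //; by rewrite -h|left; split=> //].
exact: cv_fun ab (cv_sym h).
Qed.

Lemma down_cv z x a b : down z x b -> cv b a -> up z x a.
Proof.
case: z => [c|c|p q a0 b0] //=.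
  by case=> -> h k; split=> //; exact: cv_fun k (cv_sym h).
case=> -[-> h] ab; [right; split=> //; by rewrite -h|left; split=> //].
exact: cv_fun ab (cv_sym h).
Qed.

Lemma up_down_cv z x a b : valid z -> up z x a -> down z x b -> cv a b.
Proof.
case: z => [c|c|p q a0 b0] //; first by move=> _ [_ ->] [].
(* In the first and last cases [x] is read once as [p] and once as [q], which forces [p = q]. *)
move=> vz /= [] [-> ha] [] [].
- by move=> e; move: vz; rewrite -e => /node_eq_cv; rewrite ha => ? ->.
- by move=> _; rewrite ha.
- by move=> _ ->; exact: cv_sym.
- move=> e hb; move: vz; rewrite e => /node_eq_cv ab.
  by rewrite -(cv_fun ab hb); exact: cv_sym.
Qed.

Lemma up_inj z x a a' : valid z -> up z x a -> up z x a' -> a = a'.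
Proof.
case: z => [c|c|p q a0 b0] //; first by move=> _ [_ ->] [].
move=> vz /= [] [-> ha] [] [].
- by rewrite ha.
- move=> e; move: vz; rewrite -e => /node_eq_cv /cv_sym h /(cv_fun h).
  by rewrite ha.
- move=> e ->; move: vz; rewrite e => /node_eq_cv /cv_sym h.
  exact: cv_fun ha h.
- by move=> _; exact: cv_fun ha.
Qed.

Lemma down_inj z x a a' : valid z -> down z x a -> down z x a' -> a = a'.
Proof.
case: z => [c|c|p q a0 b0] //; first by move=> _ [_ h] [_]; exact: cv_fun h.
move=> vz /= [] [-> ha] [] [].
- by rewrite ha.
- move=> e; move: vz; rewrite -e => /node_eq_cv h /(cv_fun h).
  by rewrite ha.
- move=> e ->; move: vz; rewrite e => /node_eq_cv h.
  exact: cv_fun ha h.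
- by move=> _; exact: cv_fun ha.
Qed.

Lemma up_nidat z x a : valid z -> up z x a -> ~ idat a.
Proof.
case: z => [c|c|p q a0 b0] //=; first by move=> vc [_ ->].
case=> _ _ Na Nb _ [] [_]; first by move=> ->.
by move=> h /(idat_of_cv h).
Qed.

Lemma down_nidat z x a : valid z -> down z x a -> ~ idat a.
Proof.
case: z => [c|c|p q a0 b0] //=; first by move=> vc [_ h] /(idat_of_cv h).
case=> _ _ Na Nb _ [] [_]; first by move=> ->.
by move=> h /(idat_of_cv h).
Qed.

(** Between distinct points, asymmetry of parenthood leaves only one of [up] and [down] possible. *)
Lemma label_inj u v c c' : valid u -> valid v ->
  label u v c -> label u v c' -> c = c'.
Proof.
move=> vu vv; have [<-|uv] := pselect (u = v).
  by move=> /label_diag h /label_diag; exact: loop_inj h.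
move=> [[]//|h|h] [[]//|k|k].
- exact: up_inj h k.
- by case: (@parent_asym u v); [exact: down_parent k|exact: up_parent h].
- by case: (@parent_asym u v); [exact: down_parent h|exact: up_parent k].
- exact: down_inj h k.
Qed.

Lemma label_cv u v c c' : label u v c -> cv c c' -> label v u c'.
Proof.
case=> [[<- h] k|h k|h k].
- apply: Or31; split=> //.
  by rewrite -(cv_fun (idat_conv (loop_idat h)) k).
- by apply: Or33; exact: up_cv h k.
- by apply: Or32; exact: down_cv h k.
Qed.

Lemma label_rev u v c c' : valid u -> valid v ->
  label u v c -> label v u c' -> cv c c'.
Proof.
move=> vu vv; have [<-|uv] := pselect (u = v).
  move=> /label_diag h /label_diag /(loop_inj h) <-.
  exact/idat_conv/(loop_idat h).
move=> [[]//|h|h] [[e]|k|k]; try by case: uv.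
- by case: (@parent_asym u v); [exact: up_parent k|exact: up_parent h].
- exact: up_down_cv h k.
- exact/cv_sym/(up_down_cv vu k h).
- by case: (@parent_asym u v); [exact: down_parent h|exact: down_parent k].
Qed.

Lemma label_idat u v c : valid u -> valid v -> label u v c -> idat c <-> u = v.
Proof.
move=> vu vv h; split=> [Ic|uv]; last first.
  by move: h; rewrite uv => /label_diag/loop_idat.
by case: h => [[]//|/(up_nidat vv)|/(down_nidat vu)].
Qed.

Let loop_spec u v c :=
  forall e, (loop u e <-> lid c e) /\ (loop v e <-> rid c e).

(** By induction on the tree, along the parents of the later endpoint: (Ax9) carries the identities
    at the ends of the edge below a node over to its two factors. The equivalences also make missing
    loops match missing identities. *)
Lemma label_loop u v l : valid u -> valid v -> label u v l -> loop_spec u v l.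
Proof.
have diag z d : loop z d -> loop_spec z z d.
  move=> zd e; have Id := loop_idat zd.
  rewrite idat_lid // idat_rid //.
  by split; (split=> [ze|-> //]; exact: loop_inj ze zd).
have rev x y a b : cv a b -> loop_spec x y a -> loop_spec y x b.
  move=> ab h e; case: (h e) => h1 h2.
  by rewrite h1 h2 -(lid_cv e ab) -(lid_cv e (cv_sym ab)).
have step z : valid z -> (forall x a, up z x a -> loop_spec x z a) /\
    (forall x a, down z x a -> loop_spec z x a).
  elim: z => [d|d|p IHp q IHq a b] //.
    move=> _; have h : loop_spec (root d) (top d) d by [].
    split=> x a /= [-> k]; first by rewrite k.
    exact: rev k h.
  case=> vp vq _ _ [c [pq abc]].
  have hc : loop_spec p q c.
    case: pq => [[<-]|h|h]; first exact: diag.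
      exact: (IHq vq).1 h.
    exact: (IHp vp).2 h.
  have ha : loop_spec p (node p q a b) a.
    by move=> e; split=> //; rewrite (hc e).1 (lid_src e abc).
  have hb : loop_spec (node p q a b) q b.
    by move=> e; rewrite (hc e).2 (rid_tgt e abc) -(rid_mid e abc).
  split=> x d /= [] [-> k]; try by rewrite k.
    exact: rev k hb.
  exact: rev k ha.
move=> vu vv [[<-]|h|h]; first exact: diag.
  exact: (step v vv).1 h.
exact: (step u vu).2 h.
Qed.

Let consistent x y z := forall a b c,
  label x y a -> label y z b -> label x z c -> tri a b c.

(* All orders of the three points are reached from [p, z, q] by reversing, one
   at a time, an edge which is a factor of the current triangle. *)
Lemma node_consistent p q a b (z := node p q a b) : valid z ->
  [/\ consistent p z q, consistent z p q & consistent p q z] /\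
  [/\ consistent z q p, consistent q p z & consistent q z p].
Proof.
move=> vz; case: (vz) => vp vq Na Nb [c [pq abc]].
have pz : label p z a by apply: Or32; left.
have zq : label z q b by apply: Or33; left.
have La d : label p z d -> d = a by move=> /label_inj; exact.
have Lb d : label z q d -> d = b by move=> /label_inj; exact.
have Lc d : label p q d -> d = c by move=> /label_inj; exact.
have Va d : label z p d -> cv a d by exact: label_rev.
have Vb d : label q z d -> cv b d by exact: label_rev.
have Vc d : label q p d -> cv c d by exact: label_rev.
do 2!split; move=> d1 d2 d3.
- by move=> /La -> /Lb -> /Lc ->.
- by move=> /Va h /Lc -> /Lb ->; exact: tri_revl abc h.
- by move=> /Lc -> /Vb h /La ->; exact: tri_revr abc h.
- by move=> /Lb -> /Vc hc /Va ha; exact: tri_revr (tri_revl abc ha) hc.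
- by move=> /Vc hc /La -> /Vb hb; exact: tri_revl (tri_revr abc hb) hc.
- move=> /Vb hb /Va ha /Vc hc.
  exact: tri_revl (tri_revr (tri_revl abc ha) hc) hb.
Qed.

(** A top has a single parent, and two distinct parents of a node are its [p] and [q] in some
    order. *)
Lemma parents_consistent x y z : valid z ->
  parent z x -> parent z y -> x <> y ->
  [/\ consistent x z y, consistent z x y & consistent x y z].
Proof.
have two p q a b w : parent (node p q a b) w -> w = p \/ w = q.
  by move=> [d] [] [] []; tauto.
case: z => [c|c|p q a b] vz; first by case=> ? [].
  by move=> [d] h [d'] h' []; case: h h' => -[-> _] [] [-> _].
have [[? ? ?] [? ? ?]] := node_consistent vz.
by move=> /two [] -> /two [] -> //; split.
Qed.

(** If two points coincide, one label is an identity and [label_loop] applies. Otherwise all three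
    pairs are related by parenthood, and acyclicity gives one point having the other two as
    parents. *)
Lemma label_tri u w v a b c : valid u -> valid w -> valid v ->
  label u w a -> label w v b -> label u v c -> tri a b c.
Proof.
move=> vu vw vv uw wv uv.
have [e|nuw] := pselect (u = w).
  move: uw wv; rewrite -e => /label_diag uw /(label_inj vu vv uv) <-.
  by move: uw; rewrite ((label_loop vu vv uv a).1) => -[].
have [e|nwv] := pselect (w = v).
  move: uw wv; rewrite e => uw /label_diag; rewrite -(label_inj vu vv uv uw).
  by rewrite ((label_loop vu vv uv b).2) => -[].
have [e|nuv] := pselect (u = v).
  move: wv uv; rewrite -e => wu /label_diag.
  rewrite ((label_loop vu vw uw c).1) => -[_ ca].
  exact: tri_revr ca (label_rev vu vw uw wu).
suff : consistent u w v by exact.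
have from_w : parent w u -> parent w v -> consistent u w v.
  by move=> h k; case: (parents_consistent vw h k nuv).
have from_u : parent u w -> parent u v -> consistent u w v.
  by move=> h k; case: (parents_consistent vu h k nwv).
have from_v : parent v u -> parent v w -> consistent u w v.
  by move=> h k; case: (parents_consistent vv h k nuw).
have cyc x y z : parent x y -> parent y z -> parent z x -> False.
  move=> /parent_height h /parent_height h1 /parent_height h2.
  by move: (ltn_trans (ltn_trans h1 h) h2); rewrite ltnn.
case: (label_parent uw nuw) (label_parent wv nwv) (label_parent uv nuv)
  => h1 [h2|h2] [h3|h3]; try tauto.
- by case: (cyc u w v).
- by case: (cyc u v w).
Qed.

(** An identity factor is witnessed by an endpoint of the edge, whose loop comes from [label_loop];
    otherwise the fresh node is valid. *)
Lemma label_witness u v a b c : valid u -> valid v -> label u v c ->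
  tri a b c -> exists z, [/\ valid z, label u z a & label z v b].
Proof.
move=> vu vv uv abc.
have [Ia|Na] := pselect (idat a).
  have e := idat_l Ia abc; exists u; split=> //; last by rewrite -e.
  apply: Or31; split=> //.
  by apply/((label_loop vu vv uv a).1); split=> //; rewrite {1}e.
have [Ib|Nb] := pselect (idat b).
  have e := idat_r Ib abc; exists v; split=> //; first by rewrite -e.
  apply: Or31; split=> //.
  by apply/((label_loop vu vv uv b).2); split=> //; rewrite {1}e.
exists (node u v a b); split; last by apply: Or33; left.
  by split=> //; exists c.
by apply: Or32; left.
Qed.

Lemma label_ex c : exists u v, [/\ valid u, valid v & label u v c].
Proof.
have [Ic|Nc] := pselect (idat c).
  exists (root c), (root c); split=> //; apply: Or31; split=> //.
  by apply/idat_lid.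
by exists (root c), (top c); split=> //; apply: Or32.
Qed.

End Network.

(** * Ultrafilters *)

Section BooleanAlgebra.
Local Open Scope relalg_scope.
Variables (A : relalg) (BA : boolean_algebra A).
Implicit Types x y z u v : A.

Lemma joinxx x : x <= x.
Proof. by rewrite -{2}(ba_meet1 BA x) (ba_joinK BA). Qed.

Lemma le_trans y x z : x <= y -> y <= z -> x <= z.
Proof. by move=> xy <-; rewrite (ba_joinA BA) xy. Qed.

Lemma le_joinl x y : x <= x + y.
Proof. by rewrite (ba_joinA BA) joinxx. Qed.

Lemma le_joinr x y : y <= x + y.
Proof. by rewrite (ba_joinC BA x) le_joinl. Qed.

Lemma join_lub x y z : x <= z -> y <= z -> x + y <= z.
Proof. by move=> xz yz; rewrite -(ba_joinA BA) yz. Qed.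

Lemma join_mono x y z t : x <= y -> z <= t -> x + z <= y + t.
Proof.
by move=> xy zt; apply: join_lub;
  [exact: le_trans xy (le_joinl _ _)|exact: le_trans zt (le_joinr _ _)].
Qed.

Lemma le_meet x y : x <= y <-> x * y = x.
Proof.
split=> [<-|<-]; first exact: (ba_meetK BA).
by rewrite (ba_joinC BA) (ba_meetC BA) (ba_joinK BA).
Qed.

Lemma meet_glb x y z : x <= y -> x <= z -> x <= y * z.
Proof.
by move=> /le_meet xy /le_meet xz; apply/le_meet; rewrite (ba_meetA BA) xy.
Qed.

Lemma meet_lel x y : x * y <= x.
Proof. by rewrite (ba_joinC BA) (ba_joinK BA). Qed.

Lemma meet_ler x y : x * y <= y.
Proof. by rewrite (ba_meetC BA) meet_lel. Qed.

Lemma lex1 x : x <= 1.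
Proof. by apply/le_meet; exact: (ba_meet1 BA). Qed.

Record ideal (J : set A) : Prop := Ideal {
  ideal0 : J 0;
  idealD : forall x y, J x -> J y -> J (x + y);
  ideal_le : forall x y, x <= y -> J y -> J x }.

(** Zorn's lemma for the ideals that contain [J] and omit [x]; the last clause restates maximality,
    as adding [u] must capture [x]. *)
Lemma maximal_ideal (J : set A) x : ideal J -> ~ J x ->
  exists M, [/\ ideal M, J `<=` M, ~ M x
    & forall u, ~ M u -> exists2 m, M m & x <= m + u].
Proof.
move=> Ji Jx.
(* Adjoining [J] to [X] lets the empty chain, whose union is empty, satisfy [P]. *)
pose P (X : set A) := ideal (J `|` X) /\ ~ (J `|` X) x.
have [|X [[Xi Xx] Xmax]] := @Zorn_bigcup A P.
  move=> F FP tot; split; last first.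
    by move=> [//|[X FX Xx]]; case: (FP X FX) => _; apply; right.
  split; first by left; exact: ideal0.
    move=> y z [Jy|[X FX Xy]] [Jz|[Y FY Yz]].
    - by left; exact: idealD.
    - by have [?|?] := idealD (FP _ FY).1 (or_introl Jy) (or_intror Yz);
        [left|right; exists Y].
    - by have [?|?] := idealD (FP _ FX).1 (or_intror Xy) (or_introl Jz);
        [left|right; exists X].
    - have [Z [FZ Zy Zz]] : exists Z, [/\ F Z, Z y & Z z].
        case: (tot X Y FX FY) => s; first by exists Y; split=> //; exact: s.
        by exists X; split=> //; exact: s.
      by have [?|?] := idealD (FP _ FZ).1 (or_intror Zy) (or_intror Zz);
        [left|right; exists Z].
  move=> y z yz [Jz|[X FX Xz]]; first by left; exact: ideal_le yz Jz.
  by have [?|?] := ideal_le (FP _ FX).1 yz (or_intror Xz);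
    [left|right; exists X].
exists (J `|` X); split=> // u Mu.
apply: contrapT => nx.
(* The ideal generated by the maximal one and [u]. *)
pose Y := [set y | exists2 m, (J `|` X) m & y <= m + u].
have sub : J `|` X `<=` Y by move=> y My; exists y => //; exact: le_joinl.
have JY : J `|` Y = Y.
  by apply/seteqP; split=> y; [case=> // Jy; apply: sub; left|right].
apply: (Xmax Y).
  split; last by move=> /(_ u) YX; apply: Mu; right; apply: YX; exists 0;
    [exact: ideal0|exact: le_joinr].
  by move=> y Xy; apply: sub; right.
split; rewrite JY; last by move=> [m Mm xm]; apply: nx; exists m.
split; first by apply: sub; exact: ideal0.
  move=> y z [m Mm ym] [n Mn zn]; exists (m + n); first exact: idealD.
  apply: join_lub; [apply: le_trans ym _|apply: le_trans zn _];
    by apply: join_mono; rewrite ?joinxx ?le_joinl ?le_joinr.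
by move=> y z yz [m Mm zm]; exists m => //; exact: le_trans yz zm.
Qed.

End BooleanAlgebra.

(** * Ultrafilters and the prime filter theorem *)

Section Ultra.
Local Open Scope relalg_scope.

(** An ultrafilter as a Boolean homomorphism into [Prop], so that membership can be computed by
    rewriting. *)
Record ultra (A : relalg) := Ultra {
  ultra_mem :> A -> Prop;
  ultraI : forall x y, ultra_mem (x * y) = (ultra_mem x /\ ultra_mem y);
  ultraC : forall x, ultra_mem (- x) = (~ ultra_mem x) }.

Variables (A : relalg) (BA : boolean_algebra A).
Implicit Types (x y z : A) (F G : ultra A).

Lemma ultra0 F : F 0 = False.
Proof.
by rewrite -(ba_meetN BA 0) ultraI ultraC; apply/propext; split=> // -[].
Qed.

Lemma ultraU F x y : F (x + y) = (F x \/ F y).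
Proof.
apply/propext; split=> [Fxy|[Fx|Fy]].
- have [|nx] := pselect (F x); first by left.
  have : F (- x * (x + y)) by rewrite ultraI ultraC.
  rewrite (ba_meetDr BA) (ba_meetC BA _ x) (ba_meetN BA) (ba_joinC BA).
  by rewrite (ba_join0 BA) ultraI => -[]; right.
- by move: Fx; rewrite -{1}(ba_meetK BA x y) ultraI => -[].
- by move: Fy; rewrite -{1}(ba_meetK BA y x) (ba_joinC BA) ultraI => -[].
Qed.

Lemma ultra1 F : F 1.
Proof.
rewrite -(ba_joinN BA 0) ultraU ultraC; have [|] := pselect (F 0); tauto.
Qed.

Lemma ultra_le F x y : x <= y -> F x -> F y.
Proof. by move=> <-; rewrite ultraU; left. Qed.

Lemma ultra_ext F G : (forall x, F x -> G x) -> F = G.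
Proof.
move=> FG; have {FG} : ultra_mem F = G.
  apply/predeqP => x; split; first exact: FG.
  by move=> Gx; apply: contrapT; rewrite -ultraC => /FG; rewrite ultraC.
case: F G => [F FI FC] [G GI GC] /= FG; subst G.
by rewrite (Prop_irrelevance FI GI) (Prop_irrelevance FC GC).
Qed.

Lemma prime_filter (J : set A) x : ideal J -> ~ J x ->
  exists F : ultra A, F x /\ forall y, F y -> ~ J y.
Proof.
move=> Ji Jx; have [M [Mi JM Mx Mmax]] := maximal_ideal BA Ji Jx.
have M1 : ~ M 1 by move=> /(ideal_le Mi (lex1 BA x)).
have MI y z : (~ M (y * z)) = (~ M y /\ ~ M z).
  apply/propext; split=> [n|[/Mmax[m Mm xm] /Mmax[n Mn xn]] Myz].
    split=> My; apply: n; apply: ideal_le My => //; first exact: meet_lel.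
    exact: meet_ler.
  (* By distributivity, [x <= m + y] and [x <= n + z] give [x <= m + n + y * z], which would lie in
     [M]. *)
  apply/Mx/(ideal_le Mi)/(idealD Mi (idealD Mi Mm Mn) Myz).
  rewrite (ba_joinDr BA); apply: (meet_glb BA).
    apply: (le_trans BA) xm _; apply: (join_mono BA); rewrite ?(joinxx BA) //.
    exact: le_joinl.
  apply: (le_trans BA) xn _; apply: (join_mono BA); rewrite ?(joinxx BA) //.
  exact: le_joinr.
have MC y : (~ M (- y)) = (~ ~ M y).
  apply/propext; split=> [n My|/contrapT My n].
    have : ~ M (y * - y) by rewrite MI.
    by rewrite (ba_meetN BA); apply; exact: ideal0.
  by apply: M1; rewrite -(ba_joinN BA y); exact: idealD.
exists (Ultra MI MC); split=> //= y My Jy; exact/My/JM.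
Qed.

Lemma le_ultraP x y : x <= y <-> forall F, F x -> F y.
Proof.
split=> [xy F|h]; first exact: ultra_le.
apply: contrapT => nxy.
have J0 : ideal [set z : A | z = 0].
  split=> // [u v /= -> ->|u v /= uv v0]; first exact: ba_join0.
  by move: uv; rewrite v0 ba_join0.
have [|F [Fxy _]] := @prime_filter _ (x * - y) J0.
  move=> /= e; apply: nxy; apply/(le_meet BA).
  rewrite -{2}(ba_meet1 BA x) -(ba_joinN BA y) (ba_meetDr BA) e.
  by rewrite (ba_join0 BA).
by move: Fxy; rewrite ultraI ultraC => -[/h].
Qed.

(** This turns Boolean identities into propositional ones, settled by [tauto] after unfolding
    membership. *)
Lemma ultra_eq x y : (forall F, F x <-> F y) -> x = y.
Proof.
move=> h; have yx : y <= x by apply/le_ultraP => F /h.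
have <- : x <= y by apply/le_ultraP => F /h.
by rewrite (ba_joinC BA).
Qed.

End Ultra.

(** * The atom structure formed by the ultrafilters *)

Section UltraFrame.
Local Open Scope relalg_scope.
Variables (A : relalg) (RA : REL A).
Implicit Types (x y z u v w : A) (F G K E : ultra A).
Let BA := Ax1 RA.

Let uE := (ultraI, ultraU BA, ultraC, ultra0 BA).

Lemma rcomp_le x y z t : x <= y -> z <= t -> x ;; z <= y ;; t.
Proof.
by move=> <- <-; rewrite (Ax3l RA) !(Ax3r RA) -!(ba_joinA BA) (le_joinl BA).
Qed.

Lemma rcompx0 x : x ;; 0 = 0.
Proof.
by rewrite -(ba_join0 BA (x ;; 0)) -{2}(Ax4l RA) rcomp_le ?lex1 ?joinxx ?Ax4l.
Qed.

Lemma rcomp0x x : 0 ;; x = 0.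
Proof.
by rewrite -(ba_join0 BA (0 ;; x)) -{2}(Ax4r RA) rcomp_le ?lex1 ?joinxx ?Ax4r.
Qed.

Lemma meet0x x : 0 * x = 0.
Proof. by apply: (ultra_eq BA) => F; rewrite !uE; tauto. Qed.

Lemma meet1x x : 1 * x = x.
Proof. by rewrite (ba_meetC BA) (ba_meet1 BA). Qed.

Lemma conv0 : 0^u = 0 :> A.
Proof.
have := Ax2 RA 0 0; rewrite meet0x => ->.
by apply: (ultra_eq BA) => F; rewrite !uE; tauto.
Qed.

(** (Ax2) at [1]: a double converse keeps only the part of [x] whose reversed edges lie in the
    unit. *)
Lemma convK x : x^u^u = 1^u * x.
Proof. by rewrite -(Ax2 RA) meet1x. Qed.

Lemma conv_le1 x : 1^u * x^u = x^u.
Proof.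
by rewrite -convK (convK x) (ba_meetC BA) (Ax2 RA) (ba_meet1 BA).
Qed.

Lemma convI x y : (x * y)^u = x^u * y^u.
Proof.
rewrite -(Ax2 RA) convK (ba_meetC BA (1^u)) (ba_meetA BA) (Ax2 RA).
by rewrite (ba_meet1 BA).
Qed.

(** The part [w] of [1^u] missed by both converses is fixed by double converse, while (Ax2) makes
    [w^u] disjoint from [x] and from [- x]; so [w^u] and hence [w] vanish. *)
Lemma conv_cases x : 1^u <= x^u + (- x)^u.
Proof.
set w := 1^u * - (x^u + (- x)^u).
suff w0 : w = 0.
  apply/(le_ultraP BA) => F; have : F w = False by rewrite w0 ultra0.
  rewrite !uE => n F1; apply: contrapT => ?; rewrite -n; tauto.
have wK : w^u^u = w.
  by rewrite convK; apply: (ultra_eq BA) => F; rewrite !uE; tauto.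
have wI y : w * y^u = 0 -> w^u * y = 0 by rewrite -(Ax2 RA) => ->; exact: conv0.
have e1 : w^u * x = 0.
  by apply: wI; apply: (ultra_eq BA) => F; rewrite !uE; tauto.
have e2 : w^u * - x = 0.
  by apply: wI; apply: (ultra_eq BA) => F; rewrite !uE; tauto.
suff -> : w = 0^u by exact: conv0.
rewrite -{1}wK; congr (_^u).
by rewrite -(ba_meet1 BA (w^u)) -(ba_joinN BA x) (ba_meetDr BA) e1 e2 ba_join0.
Qed.

Definition ucomp F G K := forall x y, F x -> G y -> K (x ;; y).
Definition uconv F G := forall x, G x <-> F (x^u).

Lemma uconv_sym F G : uconv F G -> uconv G F.
Proof.
move=> h x; rewrite h convK ultraI -h.
by split=> [Fx|[]//]; split=> //; exact: ultra1.
Qed.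

Lemma uconv_fun F G K : uconv F G -> uconv F K -> G = K.
Proof. by move=> h k; apply: ultra_ext => x /h /k. Qed.

Lemma uconv_ex F : F (1^u) -> exists G, uconv F G.
Proof.
move=> F1.
have GI x y : F ((x * y)^u) = (F (x^u) /\ F (y^u)) by rewrite convI ultraI.
have GC x : F ((- x)^u) = (~ F (x^u)).
  apply/propext; split=> [n p|n].
    have : F ((x * - x)^u) by rewrite convI ultraI.
    by rewrite (ba_meetN BA) conv0 ultra0.
  by have := ultra_le BA (conv_cases x) F1; rewrite ultraU // => -[].
by exists (Ultra GI GC).
Qed.

(** If [x ;; w] were not in [G], then [K] would contain [(x^u ;; - (x ;; w)) * w], which is zero by
    (Ax5) because [x^u^u] lies below [x]. *)
Lemma ucomp_revl F G K F' : ucomp F G K -> uconv F F' -> ucomp F' K G.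
Proof.
move=> h c x w /c Fx Kw; apply: contrapT; rewrite -ultraC => n.
have : K ((x^u ;; (- (x ;; w))) * w) by rewrite ultraI; split=> //; exact: h.
rewrite (Ax5l RA) ultraI => -[]; suff -> : - (x;; w) * (x^u^u;; w) = 0.
  by rewrite rcompx0 ultra0.
have le : x^u^u ;; w <= x ;; w.
  by apply: rcomp_le; rewrite ?joinxx // convK meet_ler.
apply: (ultra_eq BA) => E; rewrite !uE; split=> // -[n' p].
exact/n'/(ultra_le BA le).
Qed.

Lemma ucomp_revr F G K G' : ucomp F G K -> uconv G G' -> ucomp K G' F.
Proof.
move=> h c w x Kw /c Gx; apply: contrapT; rewrite -ultraC => n.
have : K (((- (w ;; x)) ;; x^u) * w) by rewrite ultraI; split=> //; exact: h.
rewrite (Ax5r RA) ultraI => -[]; suff -> : - (w;; x) * (w;; x^u^u) = 0.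
  by rewrite rcomp0x ultra0.
have le : w ;; x^u^u <= w ;; x.
  by apply: rcomp_le; rewrite ?joinxx // convK meet_ler.
apply: (ultra_eq BA) => E; rewrite !uE; split=> // -[n' p].
exact/n'/(ultra_le BA le).
Qed.

Lemma uid_l E F K : E 1' -> ucomp E F K -> K = F.
Proof.
move=> E1 h; apply/esym/ultra_ext => x Fx.
exact: ultra_le (Ax6l RA x) (h _ _ E1 Fx).
Qed.

Lemma uid_r E F K : E 1' -> ucomp F E K -> K = F.
Proof.
move=> E1 h; apply/esym/ultra_ext => x Fx.
exact: ultra_le (Ax6r RA x) (h _ _ Fx E1).
Qed.

Lemma subid_l x y : (x * 1') ;; y <= y.
Proof.
apply: (le_trans BA) _ (Ax6l RA y).
by apply: rcomp_le; rewrite ?joinxx ?meet_ler.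
Qed.

Lemma subid_r x y : x ;; (y * 1') <= x.
Proof.
apply: (le_trans BA) _ (Ax6r RA x).
by apply: rcomp_le; rewrite ?joinxx ?meet_ler.
Qed.

(** The product lies below [v] since [x * 1'] is a subidentity, and below [u] by monotonicity, but
    [v] avoids [u]. *)
Lemma subid_l0 x y : (x * 1') ;; (y * - ((x * 1') ;; y)) = 0.
Proof.
set u := (x * 1') ;; y; set v := y * - u.
have le1 := subid_l x v.
have le2 : (x * 1') ;; v <= u by apply: rcomp_le; rewrite ?joinxx ?meet_lel.
apply: (ultra_eq BA) => F; rewrite ultra0 //; split=> // h.
move: (ultra_le BA le1 h) (ultra_le BA le2 h).
by rewrite /v !uE; tauto.
Qed.

Lemma subid_r0 x y : (x * - (x ;; (y * 1'))) ;; (y * 1') = 0.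
Proof.
set u := x ;; (y * 1'); set v := x * - u.
have le1 := subid_r v y.
have le2 : v ;; (y * 1') <= u by apply: rcomp_le; rewrite ?joinxx ?meet_lel.
apply: (ultra_eq BA) => F; rewrite ultra0 //; split=> // h.
move: (ultra_le BA le1 h) (ultra_le BA le2 h).
by rewrite /v !uE; tauto.
Qed.

(** By [subid_l0], a failure of [ucomp E F F] yields members whose product is zero. A vanishing
    product can be moved across brackets with (Ax9). *)
Lemma ucomp_lidP E F : E 1' ->
  (forall x y, E x -> F y -> (x * 1') ;; y = 0 -> False) -> ucomp E F F.
Proof.
move=> E1 h x y Ex Fy; apply: contrapT => n; apply: (h x _ Ex _ (subid_l0 x y)).
rewrite ultraI ultraC; split=> // k; apply: n; apply: ultra_le k => //.
by apply: rcomp_le; rewrite ?joinxx ?meet_lel.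
Qed.

Lemma ucomp_ridP E F : E 1' ->
  (forall x y, F x -> E y -> x ;; (y * 1') = 0 -> False) -> ucomp F E F.
Proof.
move=> E1 h x y Fx Ey; apply: contrapT => n; apply: (h _ y _ Ey (subid_r0 x y)).
rewrite ultraI ultraC; split=> // k; apply: n; apply: ultra_le k => //.
by apply: rcomp_le; rewrite ?joinxx ?meet_lel.
Qed.

Lemma uid_src E F G K : E 1' -> ucomp F G K -> ucomp E F F <-> ucomp E K K.
Proof.
move=> E1 h; split=> k; apply: ucomp_lidP => // x y Ex Fy e.
  have Ex1 : E (x * 1') by rewrite ultraI.
  have := h _ 1 (k _ _ Ex1 (ultra1 BA F)) (ultra1 BA G).
  rewrite (Ax9l RA) => /(ultra_le BA (rcomp_le (joinxx BA _) (lex1 BA _))).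
  (* Splitting [1] along [y], the part with [y] vanishes and the part with [- y] stays below [- y],
     which is not in [K]. *)
  rewrite -(ba_joinN BA y) (Ax3r RA) e ultraU // ultra0 // => -[//|].
  by move=> /(ultra_le BA (subid_l _ _)); rewrite ultraC.
have Ex1 : E (x * 1') by rewrite ultraI.
have := k _ _ Ex1 (h _ _ Fy (ultra1 BA G)).
by rewrite -(Ax9l RA) e rcomp0x ultra0.
Qed.

Lemma uid_mid E F G K : E 1' -> ucomp F G K -> ucomp F E F <-> ucomp E G G.
Proof.
move=> E1 h; split=> k.
  apply: ucomp_lidP => // x y Ex Gy e; have Ex1 : E (x * 1') by rewrite ultraI.
  have := h _ _ (k _ _ (ultra1 BA F) Ex1) Gy.
  by rewrite (Ax9m RA) e rcompx0 ultra0.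
apply: ucomp_ridP => // x y Fx Ey e; have Ey1 : E (y * 1') by rewrite ultraI.
have := h _ _ Fx (k _ _ Ey1 (ultra1 BA G)).
by rewrite -(Ax9m RA) e rcomp0x ultra0.
Qed.

Lemma uid_tgt E F G K : E 1' -> ucomp F G K -> ucomp G E G <-> ucomp K E K.
Proof.
move=> E1 h; split=> k; apply: ucomp_ridP => // x y Fx Ey e;
  have Ey1 : E (y * 1') by rewrite ultraI.
  have := h 1 _ (ultra1 BA F) (k _ _ (ultra1 BA G) Ey1).
  rewrite -(Ax9r RA) => /(ultra_le BA (rcomp_le (lex1 BA _) (joinxx BA _))).
  rewrite -(ba_joinN BA x) (Ax3l RA) e ultraU // ultra0 // => -[//|].
  by move=> /(ultra_le BA (subid_r _ _)); rewrite ultraC.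
have := k _ _ (h _ _ (ultra1 BA F) Fx) Ey1.
by rewrite (Ax9r RA) e rcompx0 ultra0.
Qed.

(** Split the factors of [1' ;; 1'] along [x] and [y]: the parts with [- x] or [- y] lie below these
    and are not in [E], so (Ax7) leaves the remaining product in [E]. *)
Lemma uid_ucomp E : E 1' -> ucomp E E E.
Proof.
move=> E1; apply: ucomp_lidP => // x y Ex Ey e.
have split1 z : 1' = z * 1' + - z * 1'.
  by apply: (ultra_eq BA) => F; rewrite !uE; have [] := EM (F z); tauto.
move: (E1); rewrite -(Ax7 RA) {1}(split1 x) (Ax3l RA) ultraU // => -[];
  last first.
  by move=> /(ultra_le BA (Ax6r RA _)); rewrite !uE => -[].
rewrite [X in _ ;; X](split1 y) (Ax3r RA) ultraU // => -[|]; last first.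
  by move=> /(ultra_le BA (subid_l _ _)); rewrite !uE => -[].
move=> /(ultra_le BA (rcomp_le (joinxx BA _) (meet_lel BA _ _))).
by rewrite e ultra0.
Qed.

Lemma uid_cv F G K : K 1' -> ucomp F G K ->
  (exists F', uconv F F') \/ (exists G', uconv G G').
Proof.
move=> K1 h; have [/uconv_ex|nF] := pselect (F (1^u)); first by left.
have [/uconv_ex|nG] := pselect (G (1^u)); first by right.
have : K (((- (1^u)) ;; (- (1^u))) * 1').
  by rewrite ultraI; split=> //; apply: h; rewrite ultraC.
by rewrite (Ax8 RA) ultra0.
Qed.

Definition ultra_frame : frame :=
  @Frame (ultra A) ucomp uconv (fun E => E 1') uconv_sym uconv_fun ucomp_revl
    ucomp_revr uid_l uid_r uid_ucomp uid_cv uid_src uid_mid uid_tgt.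

(** Two uses of [prime_filter]: [F] keeps every [u ;; y] in [K], then [G] keeps every [u ;; v] with
    [u] in [F] there. Additivity of composition makes the avoided sets ideals. *)
Lemma ucomp_ex K x y : K (x ;; y) -> exists F G, [/\ F x, G y & ucomp F G K].
Proof.
move=> Kxy.
have [||F [Fx FK]] := @prime_filter _ BA [set u | ~ K (u ;; y)] x.
- split=> /= [|u v nu nv|u v uv nv].
  + by rewrite rcomp0x ultra0.
  + by rewrite (Ax3l RA) ultraU //; tauto.
  + by move=> /(ultra_le BA (rcomp_le uv (joinxx BA y))).
- by apply.
have [||G [Gy GK]] := @prime_filter _ BA
    [set v | exists2 u, F u & ~ K (u ;; v)] y.
- split=> /=.
  + by exists x => //; rewrite rcompx0 ultra0.
  + move=> v1 v2 [u1 F1 n1] [u2 F2 n2]; exists (u1 * u2).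
      by rewrite ultraI.
    rewrite (Ax3r RA) ultraU // => -[].
      by move=> /(ultra_le BA (rcomp_le (meet_lel BA _ _) (joinxx BA _))).
    by move=> /(ultra_le BA (rcomp_le (meet_ler BA _ _) (joinxx BA _))).
  + move=> v1 v2 le [u Fu n]; exists u => //.
    by move=> /(ultra_le BA (rcomp_le (joinxx BA u) le)).
- by move=> [u /FK h /h].
exists F, G; split=> // u v Fu Gv; apply: contrapT => n.
by apply: (GK v Gv); exists u.
Qed.

End UltraFrame.

(** * Completeness: the representation on the labelled network *)

Section Completeness.
Local Open Scope relalg_scope.
Variables (A : relalg) (RA : REL A).
Let BA := Ax1 RA.
Local Notation point := (pt (ultra_frame RA)).

(** Invalid trees lie on no edge, so they stay outside the base. *)
Definition net_unit : set (point * point)%type :=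
  [set p | [/\ valid p.1, valid p.2 & exists F, label p.1 p.2 F]].

Definition net_rep (x : A) (p q : point) :=
  [/\ valid p, valid q &
    exists2 F : ultra_frame RA, label p q F & (F : ultra A) x].

Lemma net_repE x p q (F : ultra_frame RA) : valid p -> valid q ->
  label p q F -> net_rep x p q = (F : ultra A) x.
Proof.
move=> vp vq pq; apply/propext; split=> [[_ _ [G pqG]]|Fx].
  by rewrite (label_inj vp vq pq pqG).
by split=> //; exists F.
Qed.

Lemma net_rep_sub x p q : net_rep x p q -> net_unit (p, q).
Proof. by move=> [vp vq [F pq _]]; split=> //; exists F. Qed.

Lemma net_rep_out x p q : ~ net_unit (p, q) -> net_rep x p q = False.
Proof. by move=> n; apply/propext; split=> // /net_rep_sub. Qed.

Lemma net_rep_repr : repr net_unit net_rep.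
Proof.
split.
- exact: net_rep_sub.
- move=> x y p q; have [[vp vq [F pq]]|n] := EM (net_unit (p, q)).
    by rewrite !(net_repE _ vp vq pq) ultraU.
  by rewrite !net_rep_out //; apply/propext; tauto.
- move=> x y p q; have [[vp vq [F pq]]|n] := EM (net_unit (p, q)).
    by rewrite !(net_repE _ vp vq pq) ultraI.
  by rewrite !net_rep_out //; apply/propext; tauto.
- move=> x p q; have [[vp vq [F pq]]|n] := EM (net_unit (p, q)).
    rewrite !(net_repE _ vp vq pq) ultraC; apply/propext; split=> [?|[]//].
    by split=> //; split=> //; exists F.
  by rewrite !net_rep_out //; apply/propext; tauto.
- move=> p q; have [[vp vq [F pq]]|n] := EM (net_unit (p, q)).
    by rewrite !(net_repE _ vp vq pq) ultra0.
  by rewrite !net_rep_out.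
- move=> p q; have [W|n] := EM (net_unit (p, q)); last first.
    by rewrite net_rep_out //; apply/propext; split.
  case: (W) => vp vq [F pq]; rewrite (net_repE _ vp vq pq).
  by apply/propext; split=> // _; exact: ultra1.
- move=> x y p q; apply/propext; split.
    (* The label splits into two composable ultrafilters, and the tree holds a witness for that
       splitting. *)
    move=> [vp vq [K pq /(ucomp_ex RA) [F [G [Fx Gy FGK]]]]].
    split; first by split=> //; exists K.
    have [z [vz pz zq]] := label_witness vp vq pq FGK.
    by exists z; split; [split=> //; exists F|split=> //; exists G].
  move=> [[vp vq [K pq]] [z [[_ vz [F pz Fx]] [_ _ [G zq Gy]]]]].
  by split=> //; exists K => //; exact: (label_tri vp vz vq pz zq pq).
- move=> x p q; apply/propext; split.
    move=> [vp vq [F pq Fx]]; split; first by split=> //; exists F.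
    have [|G FG] := @uconv_ex _ RA F.
      by move: Fx; rewrite -(conv_le1 RA) ultraI => -[].
    by split=> //; exists G; [exact: label_cv pq FG|exact/FG].
  move=> [[vp vq [F pq]] [_ _ [G qp Gx]]].
  by split=> //; exists F => //; exact/(label_rev vp vq pq qp).
- move=> p q; apply/propext; split.
    move=> [vp vq [F pq /(label_idat vp vq pq) e]].
    by split=> //; split=> //; exists F.
  move=> [[vp vq [F pq]] e]; split=> //; exists F => //.
  exact/(label_idat vp vq pq).
- move=> x y h; apply: (ultra_eq BA) => F.
  have [p [q [vp vq pq]]] := @label_ex (ultra_frame RA) F.
  by rewrite -!(net_repE _ vp vq pq).
Qed.

(** A base point ends some edge; [ucomp_ex] applied to [1' ;; 1] or [1 ;; 1'] gives an identity
    ultrafilter at that end of the label, and [label_loop] turns it into a loop. *)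
Lemma net_unit_refl x : 1' ;; (1 : A) = 1 -> 1 ;; 1' = (1 : A) ->
  base net_unit x -> net_unit (x, x).
Proof.
move=> l1 r1 bx; have [y [[vx vy [K xy]]|[vy vx [K yx]]]] := base_edge bx.
  have : (K : ultra A) (1' ;; 1) by rewrite l1; exact: ultra1.
  move=> /(ucomp_ex RA) [E [G [E1 _ h]]]; split=> //; exists E.
  apply: Or31; split=> //; apply/((label_loop vx vy xy E).1); split=> //.
  by move: (h); rewrite -(uid_l RA E1 h).
have : (K : ultra A) (1 ;; 1') by rewrite r1; exact: ultra1.
move=> /(ucomp_ex RA) [G [E [_ E1 h]]]; split=> //; exists E.
apply: Or31; split=> //; apply/((label_loop vy vx yx E).2); split=> //.
by move: (h); rewrite -(uid_r RA E1 h).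
Qed.

Lemma net_unit_sym p q : (1 : A)^u = 1 -> net_unit (p, q) -> net_unit (q, p).
Proof.
move=> c1 [vp vq [F pq]]; split=> //.
have [|G FG] := @uconv_ex _ RA F; first by rewrite c1; exact: ultra1.
by exists G; exact: label_cv pq FG.
Qed.

End Completeness.

Theorem mainTheorem1 (H : set rs) (A : relalg) :
  REL_ H A <-> iso_copies (RRA H) A.
Proof.
rewrite iso_copies_RRAP; split=> [[RA As Ar]|[U [W [g [gr HW]]]]]; last first.
  exact: repr_REL_ gr HW.
exists (pt (ultra_frame RA)), (@net_unit A RA), (@net_rep A RA).
split; first exact: net_rep_repr.
split; first exact: sub_base.
  by move=> /Ar [l1 r1] x; exact: net_unit_refl.
by move=> /As c1 p q; exact: net_unit_sym.
Qed.
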